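(* Let $1\leq p<\infty$, let $(\Omega,\mu)$ be a probability space and let $E$ be a closed infinite dimensional subspace of $L_p(\Omega,\mu)$. Consider the following statements: (i) $E$ does stable phase retrieval in $L_p(\Omega,\mu)$. (ii) $E$ does stable phase retrieval in $L_1(\Omega,\mu)$ and $\|\cdot\|_{L_p}\sim\|\cdot\|_{L_1}$ on $E$. (iii) There exists $\alpha>0$ such that for all $x,y\in E$, $$\mu\big(\{t\in\Omega:|x(t)|\geq\alpha\|x\|_{L_p}\ \text{and}\ |y(t)|\geq\alpha\|y\|_{L_p}\}\big)>\alpha.$$ Then for all $1\leq p<\infty$, (iii) $\Leftrightarrow$ (ii) $\Rightarrow$ (i). Moreover, if $1\leq p<2$, all three statements are equivalent.
   Context: All $L_p$-spaces are real, and $E\subseteq L_p(\Omega,\mu)$ is regarded as a subspace of $L_1(\Omega,\mu)$ via the inclusion $L_p(\Omega,\mu)\subseteq L_1(\Omega,\mu)$. The notation $\|\cdot\|_{L_p}\sim\|\cdot\|_{L_1}$ on $E$ means that the two norms are equivalent on $E$. A subspace $E\subseteq L_r(\Omega,\mu)$ does stable phase retrieval in $L_r(\Omega,\mu)$ if there is a constant $C$ such that $\min_{\lambda\in\{1,-1\}}\|f-\lambda g\|_{L_r}\leq C\big\||f|-|g|\big\|_{L_r}$ for all $f,g\in E$. *)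

(* Defs.v *)
From HB Require Import structures.
From mathcomp Require Import all_boot all_order all_algebra.
From mathcomp Require Import all_classical all_reals all_analysis.
Import Order.TTheory GRing.Theory Num.Theory.
Import numFieldNormedType.Exports.
Set Implicit Arguments.
Unset Strict Implicit.
Unset Printing Implicit Defensive.
Local Open Scope classical_set_scope.
Local Open Scope ring_scope.

(* The elements of [LfunType mu p1] are functions (measurable, with finite
   [L_p]-norm), not classes modulo a.e. equality.  A subset of the Banach space
   [L_p] is represented by its preimage in [LfunType mu p1], i.e. by a set of
   functions that is invariant under a.e. equality.  Closedness in the sense of
   [Lp_closed] entails this invariance, since [f = g] a.e. gives
   [Lpnorm mu p (f - g) = 0]. *)

(* [fine] maps infinite values to 0; this never matters below, where the norm is
   only taken of functions that have a finite [L_p]-norm. *)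
Definition Lpnorm d (T : measurableType d) (R : realType)
    (mu : {measure set T -> \bar R}) (p : \bar R) (f : T -> R) : R :=
  fine ('N[mu]_p[EFin \o f])%E.

Section subspaces.
Context d (T : measurableType d) (R : realType).
Variables (mu : {measure set T -> \bar R}) (p : \bar R) (p1 : (1 <= p)%E).
Implicit Type E : set (LfunType mu p1).

Definition Lp_closed E : Prop :=
  forall f : LfunType mu p1,
    (forall e : R, 0 < e -> exists2 g, E g & Lpnorm mu p (f - g) < e) -> E f.

(* The dimension is that of the space of classes modulo a.e. equality. *)
Definition Lp_finite_dim E : Prop :=
  exists (n : nat) (b : 'I_n -> LfunType mu p1),
    (forall i, E (b i)) /\
    forall f, E f -> exists c : 'I_n -> R,
      (f : T -> R) = (\sum_(i < n) c i *: b i : LfunType mu p1) %[ae mu].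

Record closed_infdim_subspace E : Prop := ClosedInfdimSubspace {
  subspace_submod : submod_closed [in E] ;
  subspace_closed : Lp_closed E ;
  subspace_infdim : ~ Lp_finite_dim E }.

Definition stable_phase_retrieval E : Prop :=
  exists C : R, forall f g : LfunType mu p1, E f -> E g ->
    Num.min (Lpnorm mu p (f - g)) (Lpnorm mu p (f + g)) <=
      C * Lpnorm mu p (fun t => `|f t| - `|g t|).

End subspaces.

Section inclusion.
Context d (T : measurableType d) (R : realType) (P : probability T R).
Variables (p : \bar R) (p1 : (1 <= p)%E).

Lemma LfunType_Lfun1 (f : LfunType P p1) : (f : T -> R) \in Lfun P 1.
Proof.
have Pfin : P [set: T] \is a fin_num by rewrite probability_setT.
exact: (Lfun_subset (lexx 1%E) p1 Pfin p1 (LfunP f)).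
Qed.

Definition Lp_to_L1 (f : LfunType P p1) : LfunType P (lexx 1%E) :=
  Lfun_Sub (lexx 1%E) (LfunType_Lfun1 f).

Definition norms_equivalent_L1 (E : set (LfunType P p1)) : Prop :=
  exists c C : R, [/\ 0 < c, 0 < C & forall f, E f ->
    c * Lpnorm P 1 (Lp_to_L1 f) <= Lpnorm P p f <= C * Lpnorm P 1 (Lp_to_L1 f)].

End inclusion.

(* Main.v *)
From HB Require Import structures.
Require Import Defs.
From mathcomp Require Import all_boot all_order all_algebra.
From mathcomp Require Import all_classical all_reals all_analysis.
From mathcomp Require Import measurable_realfun ring lra.
Import Order.TTheory GRing.Theory Num.Theory.
Local Open Scope classical_set_scope.
Local Open Scope ring_scope.
Set Implicit Arguments.
Unset Strict Implicit.
Unset Printing Implicit Defensive.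

(** Put F = f + g and G = f - g.  Pointwise | |f| - |g| | = min(|F|, |G|), so a
    subspace does stable phase retrieval exactly when
    min(||F||, ||G||) <= C ||min(|F|, |G|)|| for all F, G in it
    ([spr_minabs]).  In this form (iii) gives (ii) by integrating min(|F|, |G|)
    over the set where both functions are large ([minabs_overlap]), and (ii)
    gives (i) because the L_1-norm is dominated by the L_p-norm.

    Conversely, suppose that min(|F|, |G|) is bounded below in L_r for normalized
    F and G, and that the functions |F|^r are equi-integrable over the unit
    sphere.  Where F and G are not both at least alpha, min(|F|, |G|) is at most
    alpha, hence the set where both are large must carry the mass, and by
    equi-integrability it cannot be too small ([overlap_equiintegrable]).  For
    p >= 2 this is applied with r = 1: a set bounded in L_p, p > 1, is
    equi-integrable in L_1.  For p < 2 it is applied with r = p, and the point is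
    that (i) forces the unit ball of E to be p-equi-integrable
    ([spr_not_concentrates]).

    The last fact rests on a self-improvement ([concentrates_lt1]): if functions
    in the unit ball of E keep a mass s > 0 on arbitrarily small sets, then they
    can be found with almost all of their mass on arbitrarily small sets.  Such a
    function is almost disjoint from any fixed element of E, which contradicts
    (i).  To prove it, let w be the supremum of the possible s and let x nearly
    attain it, on a small set A.  Off A, x is a bounded function plus an L_p-small
    one, since otherwise more than w could be concentrated.  Adding n such
    functions with suitable signs, the mass on the small sets grows like n.  Off
    these sets it does not: the bounded parts add up like sqrt n in L_2, thus
    contribute about n^(p/2) to the p-th power of the L_p-norm, which is o(n) as
    p < 2, and the small parts contribute a small multiple of n.

    Both kinds of remainder are measured at once by the integral of
    min(|t|^p, l t^2).  As a function of t^2 it is concave and subadditive, so it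
    satisfies half of a parallelogram law ([capped_pow_sumdiff]); therefore the
    signs can be chosen one at a time ([concentrates_step]). *)

(** * Scalar inequalities *)

Section scalar_inequalities.
Context {R : realType}.
Implicit Types (a b t u v l p q : R).

Lemma norm_normrB a b :
  `| `|a| - `|b| | = Num.min `|a - b| `|a + b|.
Proof.
wlog a0 : a / 0 <= a => [hw|].
  have [/hw//|a0] := leP 0 a.
  by rewrite -(normrN a) hw ?oppr_ge0 ?ltW// -opprD normrN (addrC (- a)) distrC minC.
wlog b0 : b / 0 <= b => [hw|].
  have [/hw//|b0] := leP 0 b.
  by rewrite -(normrN b) hw ?oppr_ge0 ?ltW// opprK minC.
rewrite (ger0_norm a0) (ger0_norm b0) min_l// (ger0_norm (addr_ge0 a0 b0)).
by rewrite ler_norml; apply/andP; split; lra.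
Qed.

Lemma powR_midpoint p u v : 1 <= p -> 0 <= u -> 0 <= v ->
  ((u + v) / 2) `^ p <= (u `^ p + v `^ p) / 2.
Proof.
move=> p1 u0 v0.
have h0 : 0 <= 2^-1 :> R by lra.
have h1 : 2^-1 <= 1 :> R by lra.
have := @convex_powR R p p1 (Itv01 h0 h1) u v.
rewrite !inE/= !in_itv/= !andbT => /(_ u0 v0) h.
rewrite convRE [X in X `^ _ <= _]convRE /= in h.
have -> : (u + v) / 2 = 2^-1 * u + (1 - 2^-1) * v by lra.
by rewrite (le_trans h)// /unstable.onem; lra.
Qed.

(** This is the convexity of the power 1/q, read through the substitution
    u^q, v^q. *)
Lemma powR_concave_midpoint q u v : 0 < q -> q <= 1 -> 0 <= u -> 0 <= v ->
  (u `^ q + v `^ q) / 2 <= ((u + v) / 2) `^ q.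
Proof.
move=> q0 q1 u0 v0.
have qi1 : 1 <= q^-1 by rewrite invf_ge1.
have := @powR_midpoint _ _ _ qi1 (powR_ge0 u q) (powR_ge0 v q).
rewrite -!powRrM mulfV ?gt_eqF// !powRr1//.
have h0 : 0 <= (u `^ q + v `^ q) / 2 by rewrite divr_ge0// addr_ge0 ?powR_ge0.
move=> /(@ge0_ler_powR _ q (ltW q0)); rewrite !nnegrE powR_ge0 divr_ge0 ?addr_ge0//.
by rewrite -powRrM mulVf ?gt_eqF// powRr1// => /(_ isT isT).
Qed.

Lemma normr_powR_sumdiff p a b : 1 <= p ->
  2 * `|a| `^ p <= `|a + b| `^ p + `|a - b| `^ p.
Proof.
move=> p1.
have h : `|a| <= (`|a + b| + `|a - b|) / 2.
  have := ler_normD (a + b) (a - b).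
  have -> : a + b + (a - b) = a * 2 by ring.
  by rewrite normrM normr_nat; lra.
have := @powR_midpoint _ _ _ p1 (normr_ge0 (a + b)) (normr_ge0 (a - b)).
have : `|a| `^ p <= ((`|a + b| + `|a - b|) / 2) `^ p.
  by rewrite ge0_ler_powR// ?nnegrE ?divr_ge0 ?addr_ge0//; lra.
lra.
Qed.

Definition concave_cap q l u : R := Num.min (u `^ q) (l * u).

(** A minimum of two concave functions is concave. *)
Lemma concave_cap_concave q l u v : 0 < q -> q <= 1 -> 0 <= u -> 0 <= v ->
  concave_cap q l u + concave_cap q l v <= 2 * concave_cap q l ((u + v) / 2).
Proof.
move=> q0 q1 u0 v0; rewrite -ler_pdivrMl// {3}/concave_cap le_min; apply/andP; split.
  rewrite mulrC (le_trans _ (@powR_concave_midpoint q u v _ _ _ _))//.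
  by rewrite ler_pM2r ?invr_gt0// lerD// ge_min lexx.
have hu : concave_cap q l u <= l * u by rewrite ge_min lexx orbT.
have hv : concave_cap q l v <= l * v by rewrite ge_min lexx orbT.
have -> : l * ((u + v) / 2) = 2^-1 * (l * u + l * v) by field.
by rewrite ler_pM2l ?invr_gt0// lerD.
Qed.

Lemma concave_cap_ge0 q l u : 0 <= l -> 0 <= u -> 0 <= concave_cap q l u.
Proof. by move=> l0 u0; rewrite le_min powR_ge0 mulr_ge0. Qed.

(** The slope to the origin decreases, as for any concave function that vanishes
    at 0. *)
Lemma concave_cap_slope q l u v : q <= 1 -> 0 <= l -> 0 <= u -> u <= v ->
  concave_cap q l v * u <= concave_cap q l u * v.
Proof.
move=> q1 l0; rewrite le_eqVlt => /predU1P[<- v0|u0 uv].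
  by rewrite mulr0 mulr_ge0// concave_cap_ge0.
have v0 : 0 < v by apply: lt_le_trans uv.
rewrite [X in _ <= X * _]/concave_cap /Num.min; case: ifP => _; last first.
  rewrite mulrAC ler_pM2r//; by rewrite ge_min lexx orbT.
apply: (@le_trans _ _ (v `^ q * u)).
  by rewrite ler_pM2r// ge_min lexx.
have -> : v = (v / u) * u by field; rewrite gt_eqF.
have vu1 : 1 <= v / u by rewrite ler_pdivlMr ?mul1r.
rewrite powRM ?(ltW u0)//; last lra.
rewrite -mulrA [X in _ <= X]mulrCA.
rewrite ler_pM2r ?mulr_gt0 ?powR_gt0//.
exact: ler1_powR.
Qed.

(** Splitting the factor u + v of the slope at u + v and bounding each half by
    the larger slope at u, respectively at v, gives subadditivity. *)
Lemma concave_cap_subadd q l u v : q <= 1 -> 0 <= l -> 0 <= u -> 0 <= v ->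
  concave_cap q l (u + v) <= concave_cap q l u + concave_cap q l v.
Proof.
move=> q1 l0 u0 v0.
have [uv0|uv0] := leP (u + v) 0.
  have -> : u = 0 by lra.
  have -> : v = 0 by lra.
  by rewrite addr0 lerDl concave_cap_ge0.
rewrite -(ler_pM2r uv0) mulrDr mulrDl lerD// concave_cap_slope//; lra.
Qed.

(** A single gauge for functions of the form (bounded) + (small in L_p): it is at
    most l t^2 on the bounded part and at most |t|^p on the rest. *)
Definition capped_pow p l t : R := Num.min (`|t| `^ p) (l * t ^+ 2).

(** For p <= 2 the gauge is thus a concave function of t^2. *)
Lemma capped_powE p l t : capped_pow p l t = concave_cap (p / 2) l (t ^+ 2).
Proof.
have -> : t ^+ 2 = `|t| `^ 2 by rewrite powR_mulrn// real_normK ?num_real.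
rewrite /capped_pow /concave_cap -powRrM (mulrC 2 (p / 2)) divfK// powR_mulrn//.
by rewrite real_normK ?num_real.
Qed.

Lemma capped_pow_ge0 p l t : 0 <= l -> 0 <= capped_pow p l t.
Proof. by move=> l0; rewrite capped_powE concave_cap_ge0// sqr_ge0. Qed.

Lemma capped_pow_le_powR p l t : capped_pow p l t <= `|t| `^ p.
Proof. by rewrite ge_min lexx. Qed.

(** The mean of (a + b)^2 and (a - b)^2 is a^2 + b^2; concavity in the square
    moves the mean inside and subadditivity splits it again. *)
Lemma capped_pow_sumdiff p l a b : 1 <= p -> p <= 2 -> 0 <= l ->
  capped_pow p l (a + b) + capped_pow p l (a - b) <=
  2 * (capped_pow p l a + capped_pow p l b).
Proof.
move=> p1 p2 l0; rewrite !capped_powE.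
apply: (@le_trans _ _ (2 * concave_cap (p / 2) l (a ^+ 2 + b ^+ 2))).
  have -> : a ^+ 2 + b ^+ 2 = ((a + b) ^+ 2 + (a - b) ^+ 2) / 2 by field.
  by rewrite concave_cap_concave ?sqr_ge0//; lra.
by rewrite ler_pM2l// concave_cap_subadd ?sqr_ge0//; lra.
Qed.

(** Since p < 2, the quadratic branch is the smaller one only on a bounded set of
    values of t. *)
Lemma powR_le_capped_pow p l : 1 <= p -> p < 2 -> 0 < l ->
  exists2 c, 0 <= c & forall t, `|t| `^ p <= c + capped_pow p l t.
Proof.
move=> p1 p2 l0; exists ((l^-1) `^ (p / (2 - p))); first exact: powR_ge0.
move=> t; rewrite /capped_pow /Num.min; case: ifPn => [_|]; first by rewrite lerDr powR_ge0.
rewrite -leNgt => h.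
apply: (@le_trans _ _ (l^-1 `^ (p / (2 - p)))); last first.
  by rewrite lerDl mulr_ge0 ?sqr_ge0 ?ltW.
have [->|t0] := eqVneq t 0; first by rewrite normr0 powR0 ?powR_ge0// gt_eqF//; lra.
have nt : 0 < `|t| by rewrite normr_gt0.
have -> : `|t| `^ p = (`|t| `^ (2 - p)) `^ (p / (2 - p)).
  by rewrite -powRrM (mulrC (2 - p)) divfK// gt_eqF//; lra.
rewrite ge0_ler_powR ?nnegrE ?powR_ge0 ?invr_ge0 ?(ltW l0)//.
  by rewrite divr_ge0//; lra.
rewrite -[X in _ <= X]mul1r ler_pdivlMr//.
rewrite -(ler_pM2r (powR_gt0 p nt)) mul1r mulrAC -powRD; last first.
  by rewrite (gt_eqF nt) implybT.
by rewrite subrK powR_mulrn// real_normK ?num_real// mulrC.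
Qed.

End scalar_inequalities.

(** * Integrals of nonnegative functions *)

Section nonnegative_integrals.
Context d (T : measurableType d) (R : realType).
Variable mu : {measure set T -> \bar R}.
Implicit Types (A B : set T) (h : T -> R).

Lemma integrable_sub A h : measurable A ->
  mu.-integrable setT (EFin \o h) -> mu.-integrable A (EFin \o h).
Proof. by move=> mA; apply: integrableS. Qed.

Lemma Rintegral_setDI A B h : measurable A -> measurable B ->
  mu.-integrable setT (EFin \o h) ->
  \int[mu]_(t in A) h t = \int[mu]_(t in A `\` B) h t + \int[mu]_(t in A `&` B) h t.
Proof.
move=> mA mB ih.
have mD := measurableD mA mB; have mI := measurableI _ _ mA mB.
rewrite -Rintegral_setU ?setUIDK//; last 2 first.
- by apply: integrable_sub => //; exact: measurableU.
- by apply/disj_setPS => t [[_ nB] [_ yB]].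
by congr (Rintegral _ _ _); rewrite setUC setUIDK.
Qed.

Lemma le_Rintegral_set A B h : measurable A -> measurable B ->
  mu.-integrable setT (EFin \o h) -> (forall t, 0 <= h t) -> A `<=` B ->
  \int[mu]_(t in A) h t <= \int[mu]_(t in B) h t.
Proof.
move=> mA mB ih h0 AB; rewrite (Rintegral_setDI mB mA ih).
by rewrite (setIidr AB) lerDr Rintegral_ge0.
Qed.

Lemma Rintegral_small h e : mu.-integrable setT (EFin \o h) ->
  (forall t, 0 <= h t) -> 0 < e ->
  exists2 r, 0 < r & forall A, measurable A -> (mu A <= r%:E)%E ->
    \int[mu]_(t in A) h t < e.
Proof.
move=> ih h0 e0; have [r [r0 rP]] := integral_normr_continuous ih e0.
exists (r / 2) => [|A mA Ar]; first by rewrite divr_gt0.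
have := rP A mA; rewrite (@eq_Rintegral _ _ _ _ _ h) => [|t _]; last by rewrite ger0_norm.
by apply; rewrite (le_lt_trans Ar)// lte_fin; lra.
Qed.

End nonnegative_integrals.

Section probability_integrals.
Context d (T : measurableType d) (R : realType) (mu : probability T R).
Implicit Types (D : set T) (h : T -> R) (c : R).

Lemma probability_fineK D : measurable D -> (fine (mu D))%:E = mu D.
Proof. by move=> mD; rewrite fineK// fin_num_measure. Qed.

Lemma Rintegral_le_cst h D c : measurable D ->
  mu.-integrable setT (EFin \o h) ->
  (forall t, D t -> h t <= c) -> \int[mu]_(t in D) h t <= c * fine (mu D).
Proof.
move=> mD ih hc; rewrite -Rintegral_cst//; apply: le_Rintegral => //.
  exact: integrable_sub.
exact: finite_measure_integrable_cst.
Qed.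

Lemma Rintegral_ge_cst h D c : measurable D ->
  mu.-integrable setT (EFin \o h) ->
  (forall t, D t -> c <= h t) -> c * fine (mu D) <= \int[mu]_(t in D) h t.
Proof.
move=> mD ih hc; rewrite -Rintegral_cst//; apply: le_Rintegral => //.
  exact: finite_measure_integrable_cst.
exact: integrable_sub.
Qed.

End probability_integrals.

(** * Masses and capped masses *)

HB.lock Definition pmass {d} {T : measurableType d} {R : realType}
    (mu : {measure set T -> \bar R}) (p : R) (f : T -> R) (D : set T) : R :=
  \int[mu]_(t in D) `|f t| `^ p.
Canonical pmass_unlockable := Unlockable pmass.unlock.

HB.lock Definition capped_mass {d} {T : measurableType d} {R : realType}
    (mu : {measure set T -> \bar R}) (p l : R) (f : T -> R) (D : set T) : R :=
  \int[mu]_(t in D) capped_pow p l (f t).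
Canonical capped_mass_unlockable := Unlockable capped_mass.unlock.

Section concentration.
Context d (T : measurableType d) (R : realType) (mu : probability T R).
Variables (p : R) (p1 : (1 <= p%:E)%E).
Implicit Types (f g : LfunType mu p1) (A B D : set T).
Implicit Types (E : set (LfunType mu p1)).

Let p_ge1 : 1 <= p. Proof. by rewrite -lee_fin. Qed.

Local Notation pmass := (pmass mu p).
Local Notation capped_mass := (capped_mass mu p).

Lemma integrable_pow f : mu.-integrable setT (EFin \o (fun t => `|f t| `^ p)).
Proof. by apply: Lfun_integrable => //; exact: LfunP. Qed.

Lemma integrable_capped_pow f l : 0 <= l ->
  mu.-integrable setT (EFin \o (fun t => capped_pow p l (f t))).
Proof.
move=> l0; apply: le_integrable (integrable_pow f) => //=.
  apply/measurable_EFinP/measurable_minr.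
    by apply: (measurableT_comp (measurable_powR _)); exact: measurableT_comp.
  by apply: measurable_funM => //; exact: measurable_funX.
move=> t _; rewrite lee_fin ger0_norm ?capped_pow_ge0// ger0_norm ?powR_ge0//.
exact: capped_pow_le_powR.
Qed.

Lemma integrable_pow_on D f : measurable D ->
  mu.-integrable D (EFin \o (fun t => `|f t| `^ p)).
Proof. by move=> mD; exact/integrable_sub/integrable_pow. Qed.

Lemma integrable_capped_pow_on D f l : 0 <= l -> measurable D ->
  mu.-integrable D (EFin \o (fun t => capped_pow p l (f t))).
Proof. by move=> l0 mD; exact/integrable_sub/integrable_capped_pow. Qed.

Lemma pmass_ge0 f D : 0 <= pmass f D.
Proof. by rewrite unlock Rintegral_ge0// => t _; exact: powR_ge0. Qed.

Lemma capped_mass_ge0 l f D : 0 <= l -> 0 <= capped_mass l f D.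
Proof. by move=> l0; rewrite unlock Rintegral_ge0// => t _; exact: capped_pow_ge0. Qed.

Lemma le_pmass f A B : measurable A -> measurable B -> A `<=` B ->
  pmass f A <= pmass f B.
Proof.
by move=> mA mB; rewrite unlock; apply: le_Rintegral_set => //; exact: integrable_pow.
Qed.

Lemma le_capped_mass l f A B : 0 <= l -> measurable A -> measurable B -> A `<=` B ->
  capped_mass l f A <= capped_mass l f B.
Proof.
move=> l0 mA mB; rewrite unlock; apply: le_Rintegral_set => //.
  exact: integrable_capped_pow.
by move=> t; exact: capped_pow_ge0.
Qed.

Lemma pmass_setDI f A B : measurable A -> measurable B ->
  pmass f A = pmass f (A `\` B) + pmass f (A `&` B).
Proof.
by move=> mA mB; rewrite unlock; apply: Rintegral_setDI => //; exact: integrable_pow.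
Qed.

Lemma pmassZ a f D : measurable D ->
  pmass (a *: f) D = `|a| `^ p * pmass f D.
Proof.
move=> mD; rewrite unlock -RintegralZl//; last exact: integrable_pow_on.
by apply: eq_Rintegral => t _; rewrite -powRM// -normrM.
Qed.

Section sum_and_difference.
Variables f g s r : LfunType mu p1.
Hypotheses (sE : forall t, s t = f t + g t) (rE : forall t, r t = f t - g t).

Lemma pmass_sumdiff_ge D : measurable D ->
  2 * pmass f D <= pmass s D + pmass r D.
Proof.
move=> mD; have int h := integrable_pow_on h mD.
rewrite unlock -(RintegralZl 2 mD (int f)) -(RintegralD mD (int s) (int r)).
apply: le_Rintegral => //; first exact: (integrableZl mD 2 (int f)).
  exact: (integrableD mD (int s) (int r)).
by move=> t _; rewrite sE rE; exact: normr_powR_sumdiff.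
Qed.

Lemma capped_mass_sumdiff l D : p <= 2 -> 0 <= l -> measurable D ->
  capped_mass l s D + capped_mass l r D <= 2 * (capped_mass l f D + capped_mass l g D).
Proof.
rewrite unlock => p2 l0 mD; have int h := integrable_capped_pow_on h l0 mD.
have intfg := integrableD mD (int f) (int g).
rewrite -!RintegralD// -RintegralZl//.
apply: le_Rintegral => //; first exact: (integrableD mD (int s) (int r)).
  exact: (integrableZl mD 2 intfg).
by move=> t _; rewrite sE rE; exact: capped_pow_sumdiff.
Qed.

End sum_and_difference.

(** On average over the sign, adding g or -g to f destroys the mass neither of f
    on A minus B nor of g on B. *)
Lemma pmass_sumdiff_setU f g (s r : LfunType mu p1) A B :
    (forall t, s t = f t + g t) -> (forall t, r t = f t - g t) ->
    measurable A -> measurable B ->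
  2 * (pmass f A - pmass f B + pmass g B) <=
  pmass s (A `|` B) + pmass r (A `|` B).
Proof.
move=> sE rE mA mB.
have mD := measurableD mA mB; have mU := measurableU _ _ mA mB.
have split h : pmass (h : LfunType mu p1) (A `|` B) = pmass h (A `\` B) + pmass h B.
  by rewrite (pmass_setDI h mU mB) setDUl setDv setU0 setUC setUK.
have fA : pmass f A <= pmass f (A `\` B) + pmass f B.
  rewrite (pmass_setDI f mA mB) lerD2l le_pmass//; first exact: measurableI.
have fD := pmass_sumdiff_ge sE rE mD.
have gB : 2 * pmass g B <= pmass s B + pmass r B.
  have -> : pmass r B = pmass (- r) B.
    by rewrite unlock; apply: eq_Rintegral => t _; rewrite -[in LHS]normrN.
  apply: (@pmass_sumdiff_ge g f) => // t; first by rewrite sE addrC.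
  by rewrite -opprB -rE.
by rewrite !split; lra.
Qed.

Lemma measurable_superlevel f M : measurable [set t | M < `|f t|].
Proof.
rewrite (_ : [set t | _] = setT `&` (fun t => M < `|f t|) @^-1` [set true]).
  by apply: measurable_fun_ltr => //; exact: measurableT_comp.
by rewrite setTI; apply/seteqP; split=> t /=.
Qed.

(** Chebyshev's inequality, with the level M matched to e. *)
Lemma superlevel_small f e M : 0 < M -> 1 <= e * M `^ p -> pmass f setT <= 1 ->
  (mu [set t | (M < `|f t|)%R] <= e%:E)%E.
Proof.
move=> M0 eM f1; have mB := measurable_superlevel f M.
rewrite -probability_fineK// lee_fin.
have : M `^ p * fine (mu [set t | M < `|f t|]) <= 1.
  apply: (le_trans _ f1); apply: (@le_trans _ _ (pmass f [set t | M < `|f t|])).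
    rewrite unlock; apply: Rintegral_ge_cst => //; first exact: integrable_pow.
    move=> t /= Mt; rewrite ge0_ler_powR ?nnegrE//; [|exact: ltW..].
    by rewrite (le_trans _ p_ge1).
  by rewrite le_pmass.
have Mp : 0 < M `^ p by rewrite powR_gt0.
by move=> h; rewrite -(ler_pM2l Mp) (le_trans h)// mulrC.
Qed.

(** Off A, the part of f above the level M is charged with its p-th power and
    the part below it with l M^2.  If A already carries nearly all the mass that a
    small set can carry, then the difference of masses on the right is small. *)
Lemma capped_mass_setC_le f A l M : 0 <= l -> 0 <= M -> measurable A ->
  capped_mass l f (~` A) <=
  pmass f (A `|` [set t | M < `|f t|]) - pmass f A + l * M ^+ 2.
Proof.
move=> l0 M0 mA; set B := [set t | _].
have mB : measurable B := measurable_superlevel f M.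
have mU := measurableU _ _ mA mB; have mC := measurableC mA.
rewrite (pmass_setDI f mU mA) setDUl setDv set0U setUK addrK !unlock.
rewrite (Rintegral_setDI mC mB); last exact: integrable_capped_pow.
rewrite addrC lerD//.
  rewrite setIC -setDE; apply: le_Rintegral; first exact: measurableD.
  - exact/integrable_capped_pow_on/measurableD.
  - exact/integrable_pow_on/measurableD.
  - by move=> t _; exact: capped_pow_le_powR.
have mCB := measurableD mC mB.
apply: (@le_trans _ _ (l * M ^+ 2 * fine (mu (~` A `\` B)))).
  apply: Rintegral_le_cst => //; first exact: integrable_capped_pow.
  move=> t [_] /= /negP; rewrite -leNgt => ftM.
  rewrite (@le_trans _ _ (l * f t ^+ 2))//; first by rewrite ge_min lexx orbT.
  by rewrite ler_wpM2l// -[f t ^+ 2]real_normK ?num_real// lerXn2r ?nnegrE.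
rewrite ler_piMr//; first by rewrite mulr_ge0// sqr_ge0.
by rewrite -lee_fin probability_fineK// probability_le1.
Qed.

End concentration.

(** * Concentration in subspaces of L_p, p < 2 *)

Section dichotomy.
Context d (T : measurableType d) (R : realType) (mu : probability T R).
Variables (p : R) (p1 : (1 <= p%:E)%E) (E : set (LfunType mu p1)).
Hypothesis submodE : submod_closed [in E].
Hypothesis p2 : p < 2.
Local Notation pmass := (pmass mu p).
Local Notation capped_mass := (capped_mass mu p).
Implicit Types (f g : LfunType mu p1) (A B D : set T).

Let p_ge1 : 1 <= p. Proof. by rewrite -lee_fin. Qed.

Lemma subspace0 : E 0.
Proof. by case: submodE; rewrite inE. Qed.

Lemma subspaceZD a f g : E f -> E g -> E (a *: f + g).
Proof. by case: submodE => _ /(_ a f g); rewrite !inE => h Ef Eg; apply: h. Qed.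

Lemma subspaceD f g : E f -> E g -> E (f + g).
Proof. by rewrite -{2}[f]scale1r; exact: subspaceZD. Qed.

Lemma subspaceZ a f : E f -> E (a *: f).
Proof. by move=> Ef; rewrite -[a *: f]addr0; apply: subspaceZD => //; exact: subspace0. Qed.

Lemma subspaceB f g : E f -> E g -> E (f - g).
Proof. by move=> Ef Eg; rewrite addrC -scaleN1r; exact: subspaceZD. Qed.

(** Failure of p-equi-integrability of the unit ball of E, with the amount s of
    mass that stays on arbitrarily small sets. *)
Definition concentrates (s : R) := forall e : R, 0 < e ->
  exists f A, [/\ E f, measurable A, (mu A <= e%:E)%E,
    pmass f setT <= 1 & s <= pmass f A].

Lemma concentrates_le s s' : s' <= s -> concentrates s -> concentrates s'.
Proof.
move=> s's h e /h [f [A [Ef mA muA f1 sf]]].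
by exists f, A; split=> //; exact: le_trans sf.
Qed.

Lemma concentrates_le1 s : concentrates s -> s <= 1.
Proof.
move=> /(_ 1 ltr01)[f [A [Ef mA muA f1 sf]]].
by rewrite (le_trans sf)// (le_trans _ f1)// le_pmass.
Qed.

Lemma concentrates_sup s : concentrates s -> exists2 w, s <= w &
  forall r, 0 < r -> concentrates (w - r) /\ ~ concentrates (w + r).
Proof.
move=> cs; pose S := [set s | concentrates s].
have Ssup : has_sup S by split; [exists s|exists 1 => t; exact: concentrates_le1].
exists (sup S); first by apply: ub_le_sup => //; exact: Ssup.2.
move=> r r0; split.
  have [t ct tr] := sup_adherent r0 Ssup.
  by apply: concentrates_le ct; exact: ltW.
move=> ct; have : sup S + r <= sup S by apply: ub_le_sup => //; exact: Ssup.2.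
by rewrite leNgt ltrDl r0.
Qed.

(** One step of the construction: the gain w does not depend on f, and g = f + x
    or f - x for a nearly extremal x.  Since the pointwise bounds only hold for
    the sum over both signs, the mass inside and the capped mass outside are
    combined into one quantity, so that one sign serves both. *)
Lemma concentrates_step K s : 0 < K -> 0 < s -> concentrates s ->
  exists w l, [/\ 0 < w, 0 < l & forall f A e, 0 < e -> E f -> measurable A ->
    (mu A <= e%:E)%E -> exists g B, [/\ E g, measurable B, (mu B <= (e + e)%:E)%E &
    pmass f A - K * capped_mass l f (~` A) + w <=
    pmass g B - K * capped_mass l g (~` B)] ].
Proof.
move=> K0 s0 /concentrates_sup[w sw wP].
have w0 : 0 < w by apply: lt_le_trans sw.
(* On average over the signs, 2 r of the mass and 3 r of the capped mass are lost. *)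
pose r := w / (8 * (1 + K)).
have r0 : 0 < r by rewrite divr_gt0// mulr_gt0//; lra.
have rE : r * (8 * (1 + K)) = w by rewrite /r divfK// gt_eqF// mulr_gt0//; lra.
have [wr nwr] := wP r r0.
have [e0 [e00 e0P]] : exists e0, 0 < e0 /\ forall f A, E f -> measurable A ->
    (mu A <= (e0 + e0)%:E)%E -> pmass f setT <= 1 -> pmass f A <= w + r.
  apply: contrapT => h; apply: nwr => e e0.
  apply: contrapT => h'; apply: h; exists (e / 2); split=> [|f A Ef mA muA f1].
    by rewrite divr_gt0.
  rewrite leNgt; apply/negP => wf; apply: h'; exists f, A; split=> //.
    by rewrite (_ : e = e / 2 + e / 2)//; lra.
  exact: ltW.
(* At this level Chebyshev gives a superlevel set of measure at most e0. *)
pose M := (e0^-1) `^ p^-1.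
have M0 : 0 < M by rewrite powR_gt0// invr_gt0.
have eM : 1 <= e0 * M `^ p.
  rewrite /M -powRrM mulVf ?gt_eqF ?(lt_le_trans ltr01)// powRr1 ?invr_ge0 ?(ltW e00)//.
  by rewrite mulfV// gt_eqF.
(* The part of the added function below the level M has capped mass at most r. *)
pose l := r / M ^+ 2.
have l0 : 0 < l by rewrite divr_gt0// exprn_gt0.
have lM : l * M ^+ 2 = r by rewrite /l divfK// gt_eqF// exprn_gt0.
exists (w / 2), l; split=> //; first by rewrite divr_gt0.
move=> f A e e_gt0 Ef mA muA.
have [e1 e10 e1P] : exists2 e1, 0 < e1 & forall B, measurable B ->
    (mu B <= e1%:E)%E -> pmass f B < r.
  by rewrite unlock; apply: Rintegral_small => //; exact: integrable_pow.
pose e2 := Num.min e (Num.min e0 e1).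
have e20 : 0 < e2 by rewrite !lt_min e_gt0 e00 e10.
have [g [B [Eg mB muB g1 gB]]] := wr e2 e20.
have mu_le c : e2 <= c -> (mu B <= c%:E)%E.
  by move=> ?; rewrite (le_trans muB)// lee_fin.
have muBe : (mu B <= e%:E)%E by rewrite mu_le// ge_min lexx.
have muBe0 : (mu B <= e0%:E)%E by rewrite mu_le// !ge_min lexx orbT.
have muBe1 : (mu B <= e1%:E)%E by rewrite mu_le// !ge_min lexx !orbT.
have fB := e1P B mB muBe1.
have mU := measurableU _ _ mA mB.
have mC := measurableC mU.
have muU : (mu (A `|` B) <= (e + e)%:E)%E.
  by rewrite (le_trans (measureU2 _ _ _))// EFinD leeD.
have capg : capped_mass l g (~` B) <= 3 * r.
  have := capped_mass_setC_le g (ltW l0) (ltW M0) mB; rewrite lM.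
  suff : pmass g (B `|` [set t | M < `|g t|]) <= w + r by lra.
  apply: e0P => //; first by apply: measurableU => //; exact: measurable_superlevel.
  rewrite (le_trans (measureU2 _ _ _))//; first exact: measurable_superlevel.
  by rewrite EFinD leeD// superlevel_small.
have [u uE] : exists u : LfunType mu p1, u = f + g by exists (f + g).
have [v vE] : exists v : LfunType mu p1, v = f - g by exists (f - g).
have Eu : E u by rewrite uE; exact: subspaceD.
have Ev : E v by rewrite vE; exact: subspaceB.
have ufg t : u t = f t + g t by rewrite uE.
have vfg t : v t = f t - g t by rewrite vE.
have mass := pmass_sumdiff_setU ufg vfg mA mB.
have caps := capped_mass_sumdiff ufg vfg (ltW p2) (ltW l0) mC.
have capf : capped_mass l f (~` (A `|` B)) <= capped_mass l f (~` A).
  by apply: le_capped_mass => //; [exact: ltW|exact: measurableC|exact: subsetC].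
have capg' : capped_mass l g (~` (A `|` B)) <= capped_mass l g (~` B).
  by apply: le_capped_mass => //; [exact: ltW|exact: measurableC|exact: subsetC].
suff [h|h] : pmass f A - K * capped_mass l f (~` A) + w / 2 <=
      pmass u (A `|` B) - K * capped_mass l u (~` (A `|` B)) \/
    pmass f A - K * capped_mass l f (~` A) + w / 2 <=
      pmass v (A `|` B) - K * capped_mass l v (~` (A `|` B)).
- by exists u, (A `|` B).
- by exists v, (A `|` B).
apply: contrapT => /not_orP[/negP + /negP]; rewrite -!ltNge => h1 h2.
have : K * (capped_mass l u (~` (A `|` B)) + capped_mass l v (~` (A `|` B))) <=
    K * (2 * (capped_mass l f (~` A) + 3 * r)) by rewrite ler_pM2l//; lra.
nra.
Qed.

(** Each step at most doubles the bound on the measure of the exceptional set, so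
    n steps are started from a set that is smaller than e by a factor 2^n. *)
Lemma concentrates_iter K s : 0 < K -> 0 < s -> concentrates s ->
  exists w l, [/\ 0 < w, 0 < l & forall n e, 0 < e -> exists f A,
    [/\ E f, measurable A, (mu A <= e%:E)%E &
    n%:R * w <= pmass f A - K * capped_mass l f (~` A)] ].
Proof.
move=> K0 s0 /(concentrates_step K0 s0)[w [l [w0 l0 step]]].
exists w, l; split=> //; elim=> [|n IH] e e0.
  exists 0, set0; split=> //; [exact: subspace0|by rewrite measure0 lee_fin ltW|].
  rewrite mul0r !unlock Rintegral_set0 sub0r oppr_ge0 pmulr_rle0//.
  rewrite (@eq_Rintegral _ _ _ _ _ (cst 0)) => [|t _]; last first.
    by rewrite /capped_pow expr0n mulr0 normr0 powR0 ?gt_eqF ?(lt_le_trans ltr01)// minxx.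
  by rewrite Rintegral_cst ?mul0r//; exact: measurableC.
have e20 : 0 < e / 2 by rewrite divr_gt0.
have [f [A [Ef mA muA hf]]] := IH _ e20.
have [g [B [Eg mB muB hg]]] := step f A _ e20 Ef mA muA.
exists g, B; split=> //; first by rewrite (_ : e = e / 2 + e / 2)//; lra.
by rewrite -natr1 mulrDl mul1r; lra.
Qed.

(** The capped mass off A controls the mass off A up to a constant c, and n is
    chosen so large that K c is less than the mass n w inside.  The ratio
    of outer to inner mass is then at most 2 / K, and normalizing finishes. *)
Lemma concentrates_lt1 s s' : 0 < s -> concentrates s -> s' < 1 -> concentrates s'.
Proof.
move=> s0 cs s'1 e e0.
(* With this K, the bound 2 / K on the outer mass is 1 - s'. *)
pose K := 2 / (1 - s').
have K0 : 0 < K by rewrite divr_gt0// subr_gt0.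
have KE : K * (1 - s') = 2 by rewrite /K divfK// gt_eqF// subr_gt0.
have [w [l [w0 l0 iterP]]] := concentrates_iter K0 s0 cs.
have [c c0 cP] := powR_le_capped_pow p_ge1 p2 l0.
pose n := (Num.truncn (K * c / w)).+1.
have nw : K * c < n%:R * w.
  by rewrite -ltr_pdivrMr// truncnS_gt.
clearbody n; have [f [A [Ef mA muA hf]]] := iterP n e e0.
have mC := measurableC mA.
have Cf : pmass f (~` A) <= c + capped_mass l f (~` A).
  have ic : mu.-integrable (~` A) (EFin \o (fun t => capped_pow p l (f t))).
    by apply: integrable_sub => //; exact/integrable_capped_pow/ltW.
  have icst : mu.-integrable (~` A) (EFin \o (fun=> c)).
    exact: finite_measure_integrable_cst.
  apply: (@le_trans _ _ (\int[mu]_(t in ~` A) (c + capped_pow p l (f t)))).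
    rewrite unlock; apply: le_Rintegral => //; first exact: integrable_pow_on.
    exact: (integrableD mC icst ic).
  rewrite RintegralD// unlock lerD2r Rintegral_cst// ler_piMr//.
  by rewrite -lee_fin probability_fineK// probability_le1.
have fT : pmass f setT = pmass f (~` A) + pmass f A.
  by rewrite (pmass_setDI f measurableT mA) setTD setTI.
have capf : 0 <= capped_mass l f (~` A).
  exact/capped_mass_ge0/ltW.
have fC0 : 0 <= pmass f (~` A) by exact: pmass_ge0.
have yx : K * pmass f (~` A) <= 2 * pmass f A.
  have : K * pmass f (~` A) <= K * (c + capped_mass l f (~` A)) by rewrite ler_pM2l.
  rewrite mulrDr; have : 0 <= pmass f A by exact: pmass_ge0.
  lra.
have x0 : 0 < pmass f A.
  have : 0 <= K * c by rewrite mulr_ge0// ltW.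
  have : 0 <= K * capped_mass l f (~` A) by rewrite mulr_ge0// ltW.
  lra.
have z0 : 0 < pmass f setT by rewrite fT; lra.
exists ((pmass f setT `^ (- p^-1)) *: f), A.
have norm : `|pmass f setT `^ (- p^-1)| `^ p = (pmass f setT)^-1.
  rewrite ger0_norm ?powR_ge0// -powRrM mulNr mulVf ?gt_eqF ?(lt_le_trans ltr01)//.
  by rewrite powR_inv1 ?ltW.
split=> //; first exact: subspaceZ.
  by rewrite pmassZ// norm mulVf// gt_eqF.
rewrite pmassZ// norm mulrC ler_pdivlMr// fT.
have : (1 - s') * (K * pmass f (~` A)) <= (1 - s') * (2 * pmass f A).
  by rewrite ler_pM2l ?subr_gt0.
rewrite mulrA (mulrC (1 - s')) KE => ?.
have : 0 <= (1 - s') * pmass f (~` A) by rewrite mulr_ge0// subr_ge0 ltW.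
lra.
Qed.

End dichotomy.

(** * Norms, minima and overlaps *)

Section norms.
Context d (T : measurableType d) (R : realType) (mu : probability T R).
Variables (p : R) (p1 : (1 <= p%:E)%E).
Implicit Types (f g : LfunType mu p1) (h k : T -> R).

Let p_ge1 : 1 <= p. Proof. by rewrite -lee_fin. Qed.
Let p_gt0 : 0 < p. Proof. exact: lt_le_trans ltr01 _. Qed.

Lemma Lpnorm_pmass h : Lpnorm mu p%:E h = pmass mu p h setT `^ p^-1.
Proof. by rewrite /Lpnorm !unlock -fine_poweR. Qed.

Lemma Lpnorm_ge0 h : 0 <= Lpnorm mu p%:E h.
Proof. by rewrite Lpnorm_pmass powR_ge0. Qed.

Lemma pmass_Lpnorm f : pmass mu p f setT = Lpnorm mu p%:E f `^ p.
Proof.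
by rewrite Lpnorm_pmass -powRrM mulVf ?gt_eqF// powRr1// pmass_ge0.
Qed.

Lemma eq_Lpnorm h k : (forall t, `|h t| = `|k t|) ->
  Lpnorm mu p%:E h = Lpnorm mu p%:E k.
Proof.
move=> hk; rewrite !Lpnorm_pmass; congr (_ `^ _); rewrite unlock.
by apply: eq_Rintegral => t _; rewrite hk.
Qed.

Lemma LpnormZ a f : Lpnorm mu p%:E (a *: f) = `|a| * Lpnorm mu p%:E f.
Proof.
rewrite !Lpnorm_pmass pmassZ// powRM ?powR_ge0 ?pmass_ge0//.
by rewrite -powRrM mulfV ?gt_eqF// powRr1.
Qed.

Lemma minabs_Lfun f g : (fun t => Num.min `|f t| `|g t|) \in Lfun mu p%:E.
Proof.
have mm : measurable_fun setT (fun t => Num.min `|f t| `|g t|).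
  by apply: measurable_minr; exact: measurableT_comp.
apply/andP; split; rewrite inE//= /finite_norm unlock poweR_lty//.
apply: (@le_lt_trans _ _ (\int[mu]_x (`|f x| `^ p)%:E)%E); last first.
  apply: integrable_lty => //; exact: integrable_pow.
have mpow h : measurable_fun setT h ->
    measurable_fun setT (fun t => (`|h t| `^ p)%:E).
  move=> mh; apply/measurable_EFinP/(measurableT_comp (measurable_powR p)).
  exact: measurableT_comp.
apply: ge0_le_integral => //=; [exact: mpow|exact: mpow|].
move=> t _; rewrite lee_fin ge0_ler_powR ?nnegrE ?(ltW p_gt0)//.
by rewrite ger0_norm ?le_min ?normr_ge0// ge_min lexx.
Qed.

(** This packaging as an element of L_p makes the norm lemmas above apply to
    min(|f|, |g|), which need not lie in E. *)
Definition minabs f g : LfunType mu p1 := Lfun_Sub p1 (minabs_Lfun f g).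

Lemma minabsE f g t : minabs f g t = Num.min `|f t| `|g t|.
Proof. by []. Qed.

Lemma pmass_minabs f g A : measurable A ->
  pmass mu p (minabs f g) setT <= pmass mu p f A + pmass mu p g (~` A).
Proof.
move=> mA; have mC := measurableC mA.
rewrite (pmass_setDI _ measurableT mA) setTD setTI addrC.
rewrite unlock; apply: lerD; apply: le_Rintegral => //;
  try exact: integrable_pow_on.
- move=> t _; rewrite minabsE ge0_ler_powR ?nnegrE ?(ltW p_gt0)//.
  by rewrite ger0_norm ?le_min ?normr_ge0// ge_min lexx.
- move=> t _; rewrite minabsE ge0_ler_powR ?nnegrE ?(ltW p_gt0)//.
  by rewrite ger0_norm ?le_min ?normr_ge0// ge_min lexx orbT.
Qed.

(** Hoelder's inequality against the constant 1 on a probability space. *)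
Lemma Lpnorm1_le f : Lpnorm mu 1 f <= Lpnorm mu p%:E f.
Proof.
have [pE|pn1] := eqVneq p 1; first by move: (f : T -> R) => h; rewrite pE.
have p_gt1 : 1 < p by rewrite lt_neqAle eq_sym pn1.
have q0 : 0 < p / (p - 1) by rewrite divr_gt0// subr_gt0.
have mf : measurable_fun setT f by [].
have pq : p^-1 + (p / (p - 1))^-1 = 1.
  by rewrite invf_div; field; rewrite gt_eqF.
have := hoelder mu mf (@measurable_cst _ _ _ _ setT (1 : R)) p_gt0 q0 pq.
rewrite Lnorm_cst1 [X in (X `^ _)%E](_ : _ = 1%E); last exact: probability_setT.
rewrite poweR1r mule1.
rewrite (_ : (f \* cst 1)%R = f); last by apply/funext => t /=; rewrite mulr1.
have h := finite_norm_fine f.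
rewrite /Lpnorm -h => /fine_le; apply => //.
have := finite_norm_fine (Lp_to_L1 f).
by move=> <-.
Qed.

(** Apply one inequality to f + g and f - g, or the other to (f + g) / 2 and
    (f - g) / 2. *)
Lemma spr_minabs (E : set (LfunType mu p1)) : submod_closed [in E] ->
  stable_phase_retrieval E <->
  exists2 C : R, 0 < C & forall f g, E f -> E g ->
    Num.min (Lpnorm mu p%:E f) (Lpnorm mu p%:E g) <= C * Lpnorm mu p%:E (minabs f g).
Proof.
move=> sE; split=> [[C CP]|[C C0 CP]]; last first.
  exists C => f g Ef Eg.
  have := CP _ _ (subspaceB sE Ef Eg) (subspaceD sE Ef Eg).
  move/le_trans; apply; rewrite ler_pM2l//.
  rewrite (@eq_Lpnorm _ (fun t => `|f t| - `|g t|))// => t.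
  by rewrite norm_normrB minabsE ger0_norm// le_min !normr_ge0.
exists (Num.max C 1) => [|f g Ef Eg]; first by rewrite lt_max ltr01 orbT.
pose u := 2^-1 *: (f + g); pose v := 2^-1 *: (f - g).
have half (h : LfunType mu p1) : 2^-1 *: (h + h) = h.
  rewrite scalerDr -scalerDl (_ : 2^-1 + 2^-1 = 1) ?scale1r//; lra.
have uvB : u - v = g by rewrite -scalerBr opprB (addrC f) addrACA subrr addr0.
have uvD : u + v = f by rewrite -scalerDr addrACA subrr addr0.
have := CP u v (subspaceZ sE _ (subspaceD sE Ef Eg)) (subspaceZ sE _ (subspaceB sE Ef Eg)).
rewrite uvB uvD minC => /le_trans; apply.
rewrite (@eq_Lpnorm _ (minabs f g)).
  by rewrite ler_wpM2r ?Lpnorm_ge0// le_max lexx.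
move=> t; rewrite norm_normrB minabsE minC.
have -> : u t - v t = g t by rewrite -[in RHS]uvB.
have -> : u t + v t = f t by rewrite -[in RHS]uvD.
by rewrite [RHS]ger0_norm// le_min !normr_ge0.
Qed.

End norms.

Section overlap.
Context d (T : measurableType d) (R : realType) (mu : probability T R).
Variables (p : R) (p1 : (1 <= p%:E)%E) (E : set (LfunType mu p1)).
Hypothesis submodE : submod_closed [in E].
Implicit Types (f g x y z : LfunType mu p1).

Let p_ge1 : 1 <= p. Proof. by rewrite -lee_fin. Qed.
Let p_gt0 : 0 < p. Proof. exact: lt_le_trans ltr01 _. Qed.

Local Notation Np := (Lpnorm mu p%:E).
Local Notation L1 := (@Lp_to_L1 _ _ _ mu p%:E p1).
Local Notation N1 f := (Lpnorm mu 1 (L1 f)).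

Definition overlap x y (a b : R) := [set t | a <= `|x t| /\ b <= `|y t|].

Lemma measurable_overlap x y a b : measurable (overlap x y a b).
Proof.
have h z c : measurable [set t | c <= `|(z : LfunType mu p1) t|].
  rewrite (_ : [set t | _] = setT `&` (fun t => c <= `|z t|) @^-1` [set true]).
    by apply: measurable_fun_ler => //; exact: measurableT_comp.
  by rewrite setTI; apply/seteqP; split=> t /=.
exact: measurableI (h x a) (h y b).
Qed.

(** If E concentrates, fix f in E with mass at least 1/2 and then g almost all of
    whose mass lies on a set A so small that f has almost no mass on it.  Then
    min(|f|, |g|) is at most |f| on A and at most |g| off A, hence small in norm. *)
Lemma spr_not_concentrates : p < 2 -> stable_phase_retrieval E ->
  forall s, 0 < s -> ~ concentrates E s.
Proof.
move=> p2 /(spr_minabs submodE)[C C0 CP] s s0 cs.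
have full := concentrates_lt1 submodE p2 s0 cs.
(* The norms of f and g are at least 1/2, so c bounds the mass of the minimum
   from below. *)
pose c := (2 * C)^-1 `^ p.
have c0 : 0 < c by rewrite powR_gt0// invr_gt0 mulr_gt0.
pose s' := Num.max 2^-1 (1 - c / 4).
have s'1 : s' < 1 by rewrite gt_max; apply/andP; split; lra.
have s'2 : 2^-1 <= s' by rewrite le_max lexx.
have s'c : 1 - c / 4 <= s' by rewrite le_max lexx orbT.
have half f A : measurable A -> s' <= pmass mu p f A -> 2^-1 <= Np f.
  move=> mA sfA; have fT : 2^-1 <= pmass mu p f setT.
    by rewrite (le_trans s'2)// (le_trans sfA)// le_pmass.
  apply: (@le_trans _ _ (2^-1 `^ p^-1)).
    by rewrite ger1_powR// ?invf_le1//; apply/andP; split; lra.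
  by rewrite Lpnorm_pmass ge0_ler_powR ?nnegrE ?pmass_ge0 ?invr_ge0// ltW.
have [f [B [Ef mB _ f1 sfB]]] := full _ s'1 1 ltr01.
have [e e0 eP] : exists2 e, 0 < e & forall A, measurable A ->
    (mu A <= e%:E)%E -> pmass mu p f A < c / 4.
  rewrite unlock; apply: Rintegral_small => //; first exact: integrable_pow.
  by rewrite divr_gt0.
have [g [A [Eg mA muA g1 sgA]]] := full _ s'1 e e0.
have gC : pmass mu p g (~` A) <= c / 4.
  have := pmass_setDI g measurableT mA; rewrite setTD setTI; lra.
have fA := eP A mA muA.
have := CP f g Ef Eg; have := pmass_minabs f g mA.
rewrite pmass_Lpnorm => mmin min_le.
have : 2^-1 <= C * Np (minabs f g).
  by rewrite (le_trans _ min_le)// le_min (half f B)// (half g A).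
rewrite -ler_pdivrMl// => hm.
have : c <= Np (minabs f g) `^ p.
  rewrite /c ge0_ler_powR ?nnegrE ?Lpnorm_ge0 ?invr_ge0 ?mulr_ge0 ?(ltW p_gt0) ?(ltW C0)//.
  by rewrite invfM mulrC.
lra.
Qed.

(** If x = 0, the condition on x holds everywhere, and the overlap of y with
    itself can be used; if both vanish the overlap is the whole space. *)
Lemma overlap_rescale alpha : alpha < 1 ->
  (forall x y, E x -> E y -> Np x = 1 -> Np y = 1 ->
    (alpha%:E < mu (overlap x y alpha alpha))%E) ->
  forall x y, E x -> E y ->
    (alpha%:E < mu (overlap x y (alpha * Np x) (alpha * Np y)))%E.
Proof.
move=> alpha1 H.
have pos x y : E x -> E y -> 0 < Np x -> 0 < Np y ->
    (alpha%:E < mu (overlap x y (alpha * Np x) (alpha * Np y)))%E.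
  move=> Ex Ey x0 y0.
  have norm1 z : 0 < Np z -> Np ((Np z)^-1 *: z) = 1.
    by move=> z0; rewrite LpnormZ ger0_norm ?invr_ge0 ?ltW// mulVf// gt_eqF.
  have scale z t : 0 < Np z ->
      (alpha <= `|((Np z)^-1 *: z) t|) = (alpha * Np z <= `|z t|).
    move=> z0; have -> : `|((Np z)^-1 *: z) t| = `|z t| / Np z.
      rewrite -[LHS]/(`|(Np z)^-1 * z t|) normrM mulrC.
      by rewrite (@ger0_norm _ (Np z)^-1)// invr_ge0 ltW.
    by rewrite ler_pdivlMr.
  have := H _ _ (subspaceZ submodE (Np x)^-1 Ex) (subspaceZ submodE (Np y)^-1 Ey)
    (norm1 x x0) (norm1 y y0).
  rewrite (_ : overlap _ _ _ _ = overlap x y (alpha * Np x) (alpha * Np y))//.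
  by apply/seteqP; split=> t; rewrite /overlap /= !scale.
have null z : ~~ (0 < Np z) -> Np z = 0.
  by rewrite lt_neqAle Lpnorm_ge0 andbT negbK => /eqP.
move=> x y Ex Ey.
have [x0|/null x0] := boolP (0 < Np x); have [y0|/null y0] := boolP (0 < Np y).
- exact: pos.
- apply: lt_le_trans (pos x x Ex Ex x0 x0) _.
  apply: le_measure; rewrite ?inE; [exact: measurable_overlap..|].
  by move=> t [? ?]; split=> //; rewrite y0 mulr0.
- apply: lt_le_trans (pos y y Ey Ey y0 y0) _.
  apply: le_measure; rewrite ?inE; [exact: measurable_overlap..|].
  by move=> t [? ?]; split=> //; rewrite x0 mulr0.
- rewrite (_ : overlap _ _ _ _ = setT) ?probability_setT ?lte_fin//.
  by apply/seteqP; split=> t // _; split; rewrite ?x0 ?y0 mulr0.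
Qed.

Lemma minabs_overlap alpha : 0 < alpha ->
  (forall x y, E x -> E y ->
    (alpha%:E < mu (overlap x y (alpha * Np x) (alpha * Np y)))%E) ->
  forall x y, E x -> E y ->
    alpha ^+ 2 * Num.min (Np x) (Np y) <= N1 (minabs x y).
Proof.
move=> a0 H x y Ex Ey; have := H x y Ex Ey; set S := overlap _ _ _ _.
have mS : measurable S := measurable_overlap _ _ _ _.
rewrite -probability_fineK// lte_fin => aS.
have m0 : 0 <= Num.min (Np x) (Np y) by rewrite le_min !Lpnorm_ge0.
rewrite (@Lpnorm_pmass _ _ _ mu 1) invr1 powRr1 ?pmass_ge0//.
apply: (@le_trans _ _ (pmass mu 1 (L1 (minabs x y)) S)); last by rewrite le_pmass.
apply: (@le_trans _ _ (alpha * Num.min (Np x) (Np y) * fine (mu S))).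
  by rewrite expr2 mulrAC ler_wpM2l ?mulr_ge0 ?(ltW a0) ?(ltW aS).
rewrite unlock; apply: Rintegral_ge_cst => //; first exact: integrable_pow.
move=> t [xt yt]; rewrite powRr1// ger0_norm ?le_min ?normr_ge0//.
rewrite !(le_trans _ xt, le_trans _ yt)// ler_pM2l// ge_min lexx ?orbT//.
Qed.

End overlap.

(** * From equi-integrability to overlap *)

Section equi_integrability.
Context d (T : measurableType d) (R : realType) (mu : probability T R).
Variables (p : R) (p1 : (1 <= p%:E)%E) (E : set (LfunType mu p1)).
Variables (r : R) (r1 : (1 <= r%:E)%E) (J : LfunType mu p1 -> LfunType mu r1).
Hypothesis JE : forall f t, J f t = f t.
Implicit Types (f g : LfunType mu p1).

(** The map J views E inside L_r, where r may differ from the exponent used for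
    normalizing: r = p and r = 1 are the two cases of interest. *)
Lemma overlap_equiintegrable c : 0 < c ->
  (forall f g, E f -> E g -> Lpnorm mu p%:E f = 1 -> Lpnorm mu p%:E g = 1 ->
    c <= pmass mu r (minabs (J f) (J g)) setT) ->
  (forall s, 0 < s -> exists2 e, 0 < e & forall f A, E f ->
    Lpnorm mu p%:E f = 1 -> measurable A -> (mu A <= e%:E)%E ->
    pmass mu r (J f) A < s) ->
  exists2 alpha, 0 < alpha & alpha < 1 /\
    forall f g, E f -> E g -> Lpnorm mu p%:E f = 1 -> Lpnorm mu p%:E g = 1 ->
    (alpha%:E < mu (overlap f g alpha alpha))%E.
Proof.
move=> c0 cmin /(_ (c / 2))[|e e0 eP]; first by rewrite divr_gt0.
have r_ge1 : 1 <= r by rewrite -lee_fin.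
have r_ge0 : 0 <= r := le_trans ler01 r_ge1.
pose alpha := Num.min e (Num.min 2^-1 (c / 2)).
have a0 : 0 < alpha by rewrite !lt_min e0 invr_gt0 ltr0n divr_gt0.
have ae : alpha <= e by rewrite ge_min lexx.
have a2 : alpha <= 2^-1 by rewrite !ge_min lexx orbT.
have ac : alpha <= c / 2 by rewrite !ge_min lexx !orbT.
clearbody alpha; exists alpha => //; split=> [|f g Ef Eg f1 g1]; first by lra.
rewrite ltNge; apply/negP => mS.
set S := overlap _ _ _ _ in mS.
have mblS : measurable S := measurable_overlap _ _ _ _.
have mC := measurableC mblS.
have fS := eP f S Ef f1 mblS (le_trans mS _).
have {}fS : pmass mu r (J f) S < c / 2 by apply: fS; rewrite lee_fin.
have := cmin f g Ef Eg f1 g1.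
rewrite (pmass_setDI _ measurableT mblS) setTD setTI.
have hS : pmass mu r (minabs (J f) (J g)) S <= pmass mu r (J f) S.
  rewrite unlock; apply: le_Rintegral => //; try exact: integrable_pow_on.
  move=> t _; rewrite minabsE ge0_ler_powR ?nnegrE//.
  by rewrite ger0_norm ?le_min ?normr_ge0// ge_min lexx.
have hC : pmass mu r (minabs (J f) (J g)) (~` S) <= c / 2.
  apply: (@le_trans _ _ (alpha * fine (mu (~` S)))); last first.
    rewrite (le_trans _ ac)// ler_piMr ?(ltW a0)//.
    by rewrite -lee_fin probability_fineK// probability_le1.
  rewrite unlock; apply: Rintegral_le_cst => //; first exact: integrable_pow.
  move=> t nS; rewrite minabsE !JE (@le_trans _ _ (alpha `^ r))//; last first.
    by rewrite ge1r_powR// a0/=; lra.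
  rewrite ge0_ler_powR ?nnegrE ?(ltW a0)//.
  rewrite ger0_norm ?le_min ?normr_ge0// ge_min.
  have [ft|ft] := leP `|f t| alpha; first by [].
  rewrite leNgt; apply/negP => gt.
  by apply: nS; split; exact: ltW.
lra.
Qed.

End equi_integrability.

(** * The three conditions *)

Section main.
Context d (T : measurableType d) (R : realType) (mu : probability T R).
Variables (p : R) (p1 : (1 <= p%:E)%E) (E : set (LfunType mu p1)).
Hypothesis submodE : submod_closed [in E].
Implicit Types (f g x y : LfunType mu p1).

Let p_ge1 : 1 <= p. Proof. by rewrite -lee_fin. Qed.
Let p_gt0 : 0 < p. Proof. exact: lt_le_trans ltr01 _. Qed.

Local Notation Np := (Lpnorm mu p%:E).
Local Notation L1 := (@Lp_to_L1 _ _ _ mu p%:E p1).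
Local Notation N1 f := (Lpnorm mu 1 (L1 f)).

Definition uniform_overlap := exists2 alpha : R, 0 < alpha & forall x y, E x -> E y ->
  (alpha%:E < mu (overlap x y (alpha * Np x) (alpha * Np y)))%E.

Definition spr_L1_equiv_norms :=
  stable_phase_retrieval (L1 @` E) /\ norms_equivalent_L1 E.

Lemma submod_L1 : submod_closed [in L1 @` E].
Proof.
split; first by rewrite inE; exists 0 => //; [exact: subspace0|exact/LfuneqP].
move=> a _ _ /[!inE] [[f Ef <-] [g Eg <-]]; exists (a *: f + g).
  exact: subspaceZD.
exact/LfuneqP.
Qed.

Lemma spr_L1P : stable_phase_retrieval (L1 @` E) <->
  exists2 C : R, 0 < C & forall f g, E f -> E g ->
    Num.min (N1 f) (N1 g) <= C * N1 (minabs f g).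
Proof.
rewrite (spr_minabs submod_L1); split=> -[C C0 CP]; exists C => //.
  by move=> f g Ef Eg; apply: CP; [exists f|exists g].
by move=> _ _ [f Ef <-] [g Eg <-]; exact: CP.
Qed.

(** The case x = y of the lower bound for min(|x|, |y|) is the equivalence of the
    norms. *)
Lemma overlap_spr_L1 : uniform_overlap -> spr_L1_equiv_norms.
Proof.
move=> [alpha a0 /(minabs_overlap a0) H]; have a20 : 0 < alpha ^- 2.
  by rewrite invr_gt0 exprn_gt0.
split.
  apply/spr_L1P; exists (alpha ^- 2) => // f g Ef Eg.
  rewrite ler_pdivlMl ?exprn_gt0// (le_trans _ (H f g Ef Eg))//.
  rewrite ler_wpM2l ?sqr_ge0// le_min !ge_min.
  have fl : N1 f <= Np f := Lpnorm1_le f; have gl : N1 g <= Np g := Lpnorm1_le g.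
  by rewrite fl gl orbT.
exists 1, (alpha ^- 2); split=> // f Ef; have fl : N1 f <= Np f := Lpnorm1_le f.
rewrite mul1r fl /= ler_pdivlMl ?exprn_gt0//.
have := H f f Ef Ef; rewrite minxx => /le_trans; apply.
suff -> : N1 (minabs f f) = N1 f by [].
apply: (@eq_Lpnorm _ _ _ mu 1) => t; rewrite -[L1 _ t]/(minabs f f t) -[L1 _ t]/(f t).
by rewrite minabsE minxx normr_id.
Qed.

Lemma spr_L1_spr : spr_L1_equiv_norms -> stable_phase_retrieval E.
Proof.
move=> [/spr_L1P[C C0 CP] [c [K [c0 K0 cK]]]].
apply/(spr_minabs submodE); exists (K * C) => [|f g Ef Eg]; first exact: mulr_gt0.
have /andP[_ fK] := cK f Ef; have /andP[_ gK] := cK g Eg.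
apply: (@le_trans _ _ (K * Num.min (N1 f) (N1 g))).
  by rewrite minr_pMr ?(ltW K0)// le_min !ge_min fK gK orbT.
rewrite -mulrA ler_wpM2l ?(ltW K0)// (le_trans (CP f g Ef Eg))//.
by rewrite ler_wpM2l ?(ltW C0)//; exact: (Lpnorm1_le (minabs f g)).
Qed.

(** That E concentrates no s > 0 is exactly the equi-integrability required. *)
Lemma spr_overlap : p < 2 -> stable_phase_retrieval E -> uniform_overlap.
Proof.
move=> p2 spr; have [C C0 CP] := (spr_minabs submodE).1 spr.
have [|||alpha a0 [a1 H]] := @overlap_equiintegrable _ _ _ mu p p1 E p p1 id
    (fun _ _ => erefl) (C^-1 `^ p); first by rewrite powR_gt0// invr_gt0.
- move=> f g Ef Eg f1 g1; have := CP f g Ef Eg.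
  rewrite f1 g1 minxx -ler_pdivrMl// mulr1 pmass_Lpnorm => h.
  by rewrite ge0_ler_powR ?nnegrE ?invr_ge0 ?Lpnorm_ge0 ?(ltW p_gt0) ?(ltW C0).
- move=> s s0; have ncs := spr_not_concentrates submodE p2 spr s0.
  apply: contrapT => h; apply: ncs => e e0; apply: contrapT => h'.
  apply: h; exists e => // f A Ef f1 mA muA; rewrite ltNge; apply/negP => sf.
  by apply: h'; exists f, A; split=> //; rewrite pmass_Lpnorm f1 powR1.
exists alpha => //; exact: overlap_rescale.
Qed.

(** For k >= 1 and p >= 2, |t| <= k + |t|^p / k, which makes the unit ball of L_p
    equi-integrable in L_1. *)
Lemma spr_L1_overlap_ge2 : 2 <= p -> spr_L1_equiv_norms -> uniform_overlap.
Proof.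
move=> p2 [/spr_L1P[C C0 CP] [c [K [c0 K0 cK]]]].
have [|||alpha a0 [a1 H]] := @overlap_equiintegrable _ _ _ mu p p1 E 1 (lexx 1%E) L1
    (fun _ _ => erefl) ((K * C)^-1); first by rewrite invr_gt0 mulr_gt0.
- move=> f g Ef Eg f1 g1; have := CP f g Ef Eg.
  have /andP[_ fK] := cK f Ef; have /andP[_ gK] := cK g Eg.
  rewrite f1 in fK; rewrite g1 in gK.
  have -> : pmass mu 1 (minabs (L1 f) (L1 g)) setT = N1 (minabs f g).
    by rewrite (@Lpnorm_pmass _ _ _ mu 1) invr1 powRr1 ?pmass_ge0.
  rewrite invfM -ler_pdivrMl// => /(le_trans _); apply.
  rewrite -ler_pdivrMl// mulr1 in fK; rewrite -ler_pdivrMl// mulr1 in gK.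
  by rewrite mulrC ler_wpM2l ?invr_ge0 ?(ltW C0)// le_min fK gK.
- move=> s s0; pose k := Num.max 1 (4 / s).
  have k1 : 1 <= k by rewrite le_max lexx.
  have ks : 4 <= s * k by rewrite -ler_pdivrMl// mulrC le_max lexx orbT.
  have k0 : 0 < k by exact: lt_le_trans k1.
  exists (s / (4 * k)) => [|f A Ef f1 mA muA].
    by rewrite divr_gt0// mulr_gt0.
  have ifp := integrable_pow_on f mA.
  have ick : mu.-integrable A (EFin \o (fun=> k)).
    exact: finite_measure_integrable_cst.
  have ifk : mu.-integrable A (EFin \o (fun t => k^-1 * `|f t| `^ p)).
    exact: (integrableZl mA k^-1 ifp).
  have : pmass mu 1 (L1 f) A <= k * fine (mu A) + k^-1 * pmass mu p f A.
    rewrite !unlock -Rintegral_cst// -RintegralZl// -RintegralD//.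
    apply: le_Rintegral => //; first exact: integrable_pow_on.
      exact: (integrableD mA ick ifk).
    move=> t _; rewrite powRr1//; have [ftk|kft] := leP `|f t| k.
      by rewrite (le_trans ftk)// lerDl mulr_ge0 ?powR_ge0// invr_ge0 ltW.
    rewrite (@le_trans _ _ (k^-1 * `|f t| `^ p))//; last by rewrite lerDr ltW.
    rewrite ler_pdivlMl// (@le_trans _ _ (`|f t| `^ 2))//.
      by rewrite powR_mulrn// expr2 ler_wpM2r// ltW.
    by rewrite ler_powR// (le_trans k1)// ltW.
  have : pmass mu p f A <= 1.
    by rewrite (@le_trans _ _ (pmass mu p f setT)) ?le_pmass// pmass_Lpnorm f1 powR1.
  have : k * fine (mu A) <= s / 4.
    rewrite -probability_fineK// lee_fin in muA.
    have -> : s / 4 = k * (s / (4 * k)) by field; rewrite gt_eqF.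
    by rewrite ler_pM2l.
  have ki : k^-1 <= s / 4 by rewrite -[k^-1]mul1r ler_pdivrMr//; lra.
  move=> kA fA.
  have : k^-1 * pmass mu p f A <= k^-1 by rewrite ler_piMr// invr_ge0 ltW.
  lra.
exists alpha => //; exact: overlap_rescale.
Qed.

End main.

Theorem theorem5p6 (d : measure_display) (Omega : measurableType d)
    (R : realType) (mu : probability Omega R)
    (p : R) (p1 : (1 <= p%:E)%E) (E : set (LfunType mu p1))
    (hE : closed_infdim_subspace E) :
  let i := stable_phase_retrieval E in
  let ii := stable_phase_retrieval (@Lp_to_L1 _ _ _ _ _ _ @` E) /\
            norms_equivalent_L1 E in
  let iii := exists2 alpha : R, 0 < alpha & forall x y, E x -> E y ->
    (alpha%:E < mu [set t | (alpha * Lpnorm mu p%:E x <= `|x t|)%R /\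
                            (alpha * Lpnorm mu p%:E y <= `|y t|)%R])%E in
  [/\ iii <-> ii, ii -> i & p < 2 -> (i <-> ii) /\ (ii <-> iii)].
Proof.
move=> i ii iii; have sE := subspace_submod hE.
have iii_ii : iii -> ii := @overlap_spr_L1 _ _ _ mu p p1 E sE.
have ii_i : ii -> i := @spr_L1_spr _ _ _ mu p p1 E sE.
have i_iii (p2 : p < 2) : i -> iii := @spr_overlap _ _ _ mu p p1 E sE p2.
have ii_iii : ii -> iii.
  have [p2|p2] := ltP p 2; first by move=> /ii_i; exact: i_iii.
  exact: (@spr_L1_overlap_ge2 _ _ _ mu p p1 E sE p2).
by split=> // p2; split; split=> //; move=> /(i_iii p2).
Qed.
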